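(* Let $X$ and $Y$ be finite-dimensional real Banach spaces and let $T:X\to Y$ be a Hahn-Banach operator of rank $k$ with $\|T\|=1$. Let $x_0\in S(X)$ satisfy $\|Tx_0\|=1$. Then $Tx_0$ belongs to a support set of $B(Y)$ of dimension at least $k-1-d(x_0)$.
   Context: All spaces are real. $S(X)$ and $B(X)$ denote the unit sphere and closed unit ball of a Banach space $X$. A bounded linear operator $T:X\to Y$ between Banach spaces is a Hahn-Banach operator if for every Banach space $Z$ and every isometric embedding of $X$ into $Z$ (regarding $X$ as a subspace of $Z$) there exists a bounded linear operator $\tilde T:Z\to Y$ with $\|\tilde T\|=\|T\|$ and $\tilde Tx=Tx$ for all $x\in X$. For a finite-dimensional space $Y$, a support set of $B(Y)$ is the intersection of $B(Y)$ with a supporting hyperplane of $B(Y)$; the dimension of a set is the dimension of its affine hull. For $x\in S(X)$, $d(x)$ is the dimension of the set $\{x^*\in S(X^* ): x^*(x)=1\}$. *)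

(* Defs.v *)
From HB Require Import structures.
From mathcomp Require Import all_boot all_order all_algebra.
From mathcomp Require Import all_classical all_reals all_analysis.
Set Implicit Arguments. Unset Strict Implicit. Unset Printing Implicit Defensive.
Import Order.TTheory GRing.Theory Num.Theory.
Import numFieldNormedType.Exports.
Local Open Scope classical_set_scope.
Local Open Scope ring_scope.

Definition unit_ball (R : realType) (X : normedModType R) : set X :=
  [set x | `|x| <= 1].
Arguments unit_ball {R} X.

Definition opnorm (R : realType) (U V : normedModType R) (f : U -> V) : R :=
  sup [set `|f u| | u in unit_ball U].

Definition dualnorm (R : realType) (U : normedModType R) (f : U -> R^o) : R :=
  sup [set `|f u| | u in unit_ball U].

Definition is_linear_functional (R : realType) (U : lmodType R) (f : U -> R^o) :=
  forall (a : R) (u v : U), f (a *: u + v) = a * f u + f v.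

Definition bounded_op (R : realType) (U V : normedModType R) (f : U -> V) :=
  exists M : R, forall u, `|f u| <= M * `|u|.

Definition lin_indep (R : realType) (V : lmodType R) (n : nat) (v : 'I_n -> V) :=
  forall c : 'I_n -> R, \sum_(i < n) c i *: v i = 0 -> forall i, c i = 0.

Definition aff_indep (R : realType) (V : lmodType R) (n : nat) (p : 'I_n.+1 -> V) :=
  forall c : 'I_n.+1 -> R,
    \sum_(i < n.+1) c i = 0 -> \sum_(i < n.+1) c i *: p i = 0 -> forall i, c i = 0.

Definition lindim_eq (R : realType) (V : lmodType R) (A : set V) (n : nat) :=
  (exists v : 'I_n -> V, (forall i, A (v i)) /\ lin_indep v) /\
  (forall v : 'I_n.+1 -> V, (forall i, A (v i)) -> ~ lin_indep v).

Definition affdim_eq (R : realType) (V : lmodType R) (A : set V) (n : nat) :=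
  (exists p : 'I_n.+1 -> V, (forall i, A (p i)) /\ aff_indep p) /\
  (forall p : 'I_n.+2 -> V, (forall i, A (p i)) -> ~ aff_indep p).

Definition affdim_ge (R : realType) (V : lmodType R) (A : set V) (m : int) :=
  exists n : nat, (m <= n%:Z)%R /\
    exists p : 'I_n.+1 -> V, (forall i, A (p i)) /\ aff_indep p.

Definition finite_dim (R : realType) (V : lmodType R) :=
  exists (n : nat) (f : {linear 'rV[R]_n -> V}), bijective f.

Definition rank_eq (R : realType) (U V : lmodType R) (T : U -> V) (k : nat) :=
  lindim_eq (range T) k.

Definition hahn_banach_op (R : realType) (X Y : normedModType R)
    (T : {linear X -> Y}) :=
  forall (Z : completeNormedModType R) (J : {linear X -> Z}),
    (forall x, `|J x| = `|x|) ->
    exists Tt : {linear Z -> Y},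
      bounded_op Tt /\ opnorm Tt = opnorm T /\ forall x, Tt (J x) = T x.

Definition norming_set (R : realType) (X : normedModType R) (x : X) : set (X -> R^o) :=
  [set f | is_linear_functional f /\ dualnorm f = 1 /\ f x = 1].

Definition support_set (R : realType) (Y : normedModType R) (S : set Y) :=
  exists (f : Y -> R^o) (c : R),
    is_linear_functional f /\ (exists y, f y != 0) /\
    (forall y, unit_ball Y y -> f y <= c) /\
    (exists y, unit_ball Y y /\ f y = c) /\
    S = unit_ball Y `&` [set y | f y = c].

(* Main.v *)
(* Extend [T] to an operator [Tt] on the space [Z] of bounded functions on the
   dual ball of [X], in which [X] sits by evaluation, and let [f] be a norm-one
   functional on [Y] with [f (T x0) = 1]. If every norming functional of [x0]
   vanishes at [x], then [x] is a limit in [Z] of vectors [z] for which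
   [x0 + t z] and [x0 - t z] lie in the unit ball for some [t > 0]. For such
   [z] the points [T x0 + t Tt z] and [T x0 - t Tt z] lie in the unit ball of
   [Y], so [f] equals [1] at both. The vectors [x] in question form a subspace
   of codimension [d + 1], on which [T] has rank at least [k - d - 1], and
   linear independence survives the small perturbation from [T x] to [Tt z]. *)
Require Import Defs.
From HB Require Import structures.
From mathcomp Require Import all_boot all_order all_algebra.
From mathcomp Require Import all_classical all_reals all_analysis.
From mathcomp Require Import lra zify.
Import Order.TTheory GRing.Theory Num.Theory.
Import numFieldNormedType.Exports.
Local Open Scope classical_set_scope.
Local Open Scope ring_scope.

(** * Elementary algebra of linear functionals *)

Section LinearFunctional.
Set Implicit Arguments.
Unset Strict Implicit.
Context {R : realType} {V : lmodType R} (f : V -> R^o).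
Hypothesis lf : is_linear_functional f.

Lemma linear_functional0 : f 0 = 0.
Proof. by have := lf 1 0 0; rewrite scale1r addr0 mul1r; lra. Qed.

Lemma linear_functionalZ (a : R) x : f (a *: x) = a * f x.
Proof. by have := lf a x 0; rewrite addr0 linear_functional0 addr0. Qed.

Lemma linear_functionalN x : f (- x) = - f x.
Proof. by rewrite -scaleN1r linear_functionalZ mulN1r. Qed.

Lemma linear_functionalD x y : f (x + y) = f x + f y.
Proof. by have := lf 1 x y; rewrite scale1r mul1r. Qed.

End LinearFunctional.

(** * The Hahn-Banach theorem by way of minimal sublinear functionals *)

Section HahnBanach.
Set Implicit Arguments.
Unset Strict Implicit.
Context {R : realType} {V : lmodType R}.
Implicit Types (p q : V -> R) (x y : V) (t e : R).

Definition sublinear p :=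
  (forall x y, p (x + y) <= p x + p y) /\
  (forall t x, 0 <= t -> p (t *: x) = t * p x).

Lemma sublinear0 p : sublinear p -> p 0 = 0.
Proof. by move=> [_ pZ]; rewrite -(scale0r 0) pZ// mul0r. Qed.

Lemma sublinear_ge_opp p x : sublinear p -> - p (- x) <= p x.
Proof.
move=> sp; rewrite -subr_ge0 opprK -(sublinear0 sp) -(subrr x).
by have [pD _] := sp; exact: pD.
Qed.

(* The largest sublinear functional below [p] whose value at [- x] is
   [- p x]. *)
Definition directional p x y : R :=
  inf [set p (y + t *: x) - t * p x | t in [set t : R | 0 <= t]].

Section directional.
Variables (p : V -> R) (x : V).
Hypothesis sp : sublinear p.

Let dset y := [set p (y + t *: x) - t * p x | t in [set t : R | 0 <= t]].

Let dset_inf y : has_inf (dset y).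
Proof.
have [pD pZ] := sp; split; first by exists (p (y + 0 *: x) - 0 * p x), 0 => //=.
(* This lower bound is subadditivity applied to [t *: x = - y + (y + t *: x)]. *)
exists (- p (- y)) => _ [t /= t0 <-].
have := pD (- y) (y + t *: x); rewrite addKr (pZ _ _ t0); lra.
Qed.

Lemma directional_le_at y t : 0 <= t ->
  directional p x y <= p (y + t *: x) - t * p x.
Proof.
by move=> t0; apply: ge_inf; [exact: (dset_inf y).2|exists t].
Qed.

Lemma directional_le y : directional p x y <= p y.
Proof.
by have := @directional_le_at y 0 (lexx 0); rewrite scale0r mul0r addr0 subr0.
Qed.

Lemma directional_opp : directional p x (- x) <= - p x.
Proof.
have := @directional_le_at (- x) 1 ler01.
by rewrite scale1r addNr (sublinear0 sp) mul1r sub0r.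
Qed.

Lemma directional_adherent y e : 0 < e ->
  exists2 t : R, 0 <= t & p (y + t *: x) - t * p x < directional p x y + e.
Proof.
by move=> e0; have [_ [t /= t0 <-]] := inf_adherent e0 (dset_inf y); exists t.
Qed.

Let directional_scale_le t y : 0 < t ->
  directional p x (t *: y) <= t * directional p x y.
Proof.
move=> t0; apply/ler_addgt0Pr => e e0.
have [s s0 sl] := directional_adherent y (divr_gt0 e0 t0).
have ts0 : 0 <= t * s by rewrite mulr_ge0// ltW.
apply: le_trans (directional_le_at _ ts0) _.
rewrite -scalerA -scalerDr (sp.2 _ _ (ltW t0)) -mulrA -mulrBr.
move: sl; rewrite -(ltr_pM2l t0) [ltRHS]mulrDr.
rewrite [t * (e / t)]mulrCA divff ?gt_eqF// mulr1.
exact: ltW.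
Qed.

Lemma directional_sublinear : sublinear (directional p x).
Proof.
have [pD pZ] := sp; split => [y z|t y].
  apply/ler_addgt0Pr => e e0; have e2 : 0 < e / 2 by rewrite divr_gt0.
  have [s s0 sl] := directional_adherent y e2.
  have [t t0 tl] := directional_adherent z e2.
  have := directional_le_at (y + z) (addr_ge0 s0 t0).
  have := pD (y + s *: x) (z + t *: x); rewrite addrACA -scalerDl; lra.
rewrite le_eqVlt => /orP[/eqP<-|t0].
  rewrite scale0r mul0r; apply/eqP; rewrite eq_le; apply/andP; split.
    by have := directional_le 0; rewrite (sublinear0 sp).
  apply: lb_le_inf; first exact: (dset_inf 0).1.
  by move=> _ [s /= s0 <-]; rewrite add0r pZ// subrr.
(* The reverse inequality is the one already proved, for the factor [t^-1] at the vector
   [t *: y]. *)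
apply/eqP; rewrite eq_le directional_scale_le//=.
have := @directional_scale_le t^-1 (t *: y).
rewrite invr_gt0 scalerA mulVf ?gt_eqF// scale1r => /(_ t0).
by rewrite -(ler_pM2l t0) mulrA divff ?gt_eqF// mul1r.
Qed.

End directional.

(** Minimality forces [directional p x = p] for every [x]; the parameter [1] in its infimum then
    yields [p y <= p (y + x) - p x], the superadditivity that is missing. *)
Lemma minimal_sublinear_linear p : sublinear p ->
  (forall q, sublinear q -> (forall x, q x <= p x) -> q = p) ->
  is_linear_functional (p : V -> R^o).
Proof.
move=> sp pmin.
have pD x y : p (x + y) = p x + p y.
  apply/eqP; rewrite eq_le sp.1 /=.
  have qp := pmin _ (directional_sublinear x sp) (directional_le x sp).
  have := @directional_le_at _ x sp y 1 ler01.
  rewrite qp scale1r mul1r [y + x]addrC; lra.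
have pN x : p (- x) = - p x.
  by have := pD x (- x); rewrite subrr (sublinear0 sp); lra.
move=> a u v; rewrite pD; congr (_ + _).
have [a0|a0] := leP 0 a; first exact: sp.2.
by rewrite -[a in LHS]opprK scaleNr pN (sp.2 (- a)) ?oppr_ge0 1?ltW// mulNr opprK.
Qed.

(* The infimum of a chain of sublinear functionals is sublinear, so Zorn's
   lemma provides a minimal one below [p]. *)
Lemma linear_below_sublinear p : sublinear p ->
  exists2 f : V -> R^o, is_linear_functional f & forall x, f x <= p x.
Proof.
move=> sp.
pose S := {q : V -> R | sublinear q /\ forall x, q x <= p x}.
(* The order is reversed, so that a maximal element in Zorn's lemma is a minimal functional. *)
pose below (q r : S) := `[< forall x, sval r x <= sval q x >].
have svalI (q r : S) : sval q = sval r -> q = r.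
  by case: q r => [q hq] [r hr] /= qr; exact: eq_exist.
have [||||[q [sq qp]] qmin] := @Zorn S below.
- by move=> q; apply/asboolP.
- move=> q r s /asboolP qr /asboolP rs; apply/asboolP => x.
  exact: le_trans (rs x) (qr x).
- move=> q r /asboolP qr /asboolP rq; apply: svalI; apply/funext => x.
  by apply/eqP; rewrite eq_le qr rq.
- move=> A Atot.
  have [[q0 Aq0]|A0] := pselect (exists q : S, A q); last first.
    exists (exist _ p (conj sp (fun=> lexx _))) => s As.
    by exfalso; apply: A0; exists s.
  pose vals x := [set sval (q : S) x | q in A].
  have vals_inf x : has_inf (vals x).
    split; first by exists (sval q0 x), q0.
    exists (- p (- x)) => _ [q Aq <-].
    apply: le_trans (sublinear_ge_opp x (proj2_sig q).1).
    by rewrite lerN2; exact: (proj2_sig q).2.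
  pose m x := inf (vals x).
  have m_le x (q : S) : A q -> m x <= sval q x.
    by move=> Aq; apply: ge_inf; [exact: (vals_inf x).2|exists q].
  have m_adh x (e : R) : 0 < e -> exists2 q : S, A q & sval q x < m x + e.
    by move=> e0; have [_ [q Aq <-]] := inf_adherent e0 (vals_inf x); exists q.
  have mZ t x : 0 < t -> m (t *: x) <= t * m x.
    move=> t0; apply/ler_addgt0Pr => e e0.
    have [q Aq ql] := m_adh x _ (divr_gt0 e0 t0).
    apply: le_trans (m_le _ _ Aq) _; rewrite ((proj2_sig q).1.2 _ _ (ltW t0)).
    move: ql; rewrite -(ltr_pM2l t0) [ltRHS]mulrDr.
    rewrite [t * (e / t)]mulrCA divff ?gt_eqF// mulr1.
    exact: ltW.
  have sm : sublinear m.
    split=> [x y|t x].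
      apply/ler_addgt0Pr => e e0; have e2 : 0 < e / 2 by rewrite divr_gt0.
      have [q Aq ql] := m_adh x _ e2; have [r Ar rl] := m_adh y _ e2.
      (* The smaller of the two near-optimal members of the chain is near-optimal at both [x] and
         [y]. *)
      have [/asboolP qr|/asboolP rq] := Atot _ _ Aq Ar.
        have := (proj2_sig r).1.1 x y; have := m_le (x + y) _ Ar.
        by have := qr x; lra.
      have := (proj2_sig q).1.1 x y; have := m_le (x + y) _ Aq.
      by have := rq y; lra.
    rewrite le_eqVlt => /orP[/eqP<-|t0].
      rewrite scale0r mul0r; apply/eqP; rewrite eq_le.
      apply/andP; split.
        by rewrite (le_trans (m_le _ _ Aq0))// (sublinear0 (proj2_sig q0).1).
      apply: lb_le_inf; first exact: (vals_inf 0).1.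
      by move=> _ [q Aq <-]; rewrite (sublinear0 (proj2_sig q).1).
    apply/eqP; rewrite eq_le mZ//=.
    have := mZ t^-1 (t *: x).
    rewrite invr_gt0 scalerA mulVf ?gt_eqF// scale1r => /(_ t0).
    by rewrite -(ler_pM2l t0) mulrA divff ?gt_eqF// mul1r.
  have mp x : m x <= p x.
    exact: le_trans (m_le _ _ Aq0) ((proj2_sig q0).2 x).
  by exists (exist _ m (conj sm mp)) => s As; apply/asboolP => x; exact: m_le.
exists q => //; apply: minimal_sublinear_linear => // r sr rq.
have rp x : r x <= p x := le_trans (rq x) (qp x).
have := qmin (exist _ r (conj sr rp)).
by move=> /(_ (introT (asboolP _) rq)) [].
Qed.

(** A linear functional below [directional p x] is at most [- p x] at [- x], hence at least [p x] at
    [x]. *)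
Theorem Hahn_Banach_at p x : sublinear p ->
  exists f : V -> R^o,
    [/\ is_linear_functional f, forall y, f y <= p y & f x = p x].
Proof.
move=> sp.
have [f lf fq] := linear_below_sublinear (directional_sublinear x sp).
have fp y : f y <= p y := le_trans (fq y) (directional_le x sp y).
exists f; split => //; apply/eqP; rewrite eq_le fp /=.
have := le_trans (fq (- x)) (directional_opp x sp).
by rewrite (linear_functionalN lf) lerN2.
Qed.

End HahnBanach.

(** * The Banach space of bounded functions with the supremum norm *)

Definition is_bounded (R : realType) (I : Type) : {pred (I -> R^o)} :=
  fun f => `[< exists M : R, forall i, `|f i| <= M >].

Lemma is_bounded_submod_closed (R : realType) (I : Type) :
  submod_closed (@is_bounded R I).
Proof.
split=> [|a f g /asboolP[M fM] /asboolP[M' gM']]; apply/asboolP.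
  by exists 0 => i; rewrite normr0.
exists (`|a| * M + M') => i.
by rewrite (le_trans (ler_normD _ _))// lerD// normrM ler_wpM2l.
Qed.

HB.instance Definition _ (R : realType) (I : Type) :=
  GRing.isSubmodClosed.Build R (I -> R^o) (@is_bounded R I)
    (@is_bounded_submod_closed R I).

Record linfty (R : realType) (I : Type) := Linfty {
  linfty_val :> I -> R^o ;
  _ : linfty_val \in @is_bounded R I }.

HB.instance Definition _ (R : realType) (I : Type) :=
  [isSub for @linfty_val R I].
HB.instance Definition _ (R : realType) (I : Type) :=
  [Choice of linfty R I by <:].
HB.instance Definition _ (R : realType) (I : Type) :=
  [SubChoice_isSubLmodule of linfty R I by <:].

Section Linfty.
Set Implicit Arguments.
Unset Strict Implicit.
Context {R : realType} {I : Type}.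
Implicit Types (f g : linfty R I) (i : I).

Definition supnorm f : R := sup [set `|f i| | i in setT].

Let supnorm_ub f : has_ubound [set `|f i| | i in setT].
Proof.
by case: f => f fb; have /asboolP[M fM] := fb; exists M => _ [i _ <-].
Qed.

Let supnorm_ge f i : `|f i| <= supnorm f.
Proof. by apply: ub_le_sup; [exact: supnorm_ub|exists i]. Qed.

Let supnorm_le f (M : R) : 0 <= M -> (forall i, `|f i| <= M) -> supnorm f <= M.
Proof.
move=> M0 fM; have [[i _]|I0] := pselect (exists i : I, True).
  by apply: ge_sup; [exists `|f i|, i|move=> _ [j _ <-]].
(* For empty [I] the supremum of the empty set is [0] by convention, whence the assumption
   [0 <= M]. *)
rewrite /supnorm (_ : [set _ | _ in _] = set0) ?sup0//.
by apply/seteqP; split => // y [i _ _]; apply: I0; exists i.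
Qed.

Let supnorm_ge0 f : 0 <= supnorm f.
Proof.
have [[i _]|I0] := pselect (exists i : I, True).
  exact: le_trans (supnorm_ge f i).
rewrite /supnorm (_ : [set _ | _ in _] = set0) ?sup0//.
by apply/seteqP; split => // y [i _ _]; apply: I0; exists i.
Qed.

Let supnormD f g : supnorm (f + g) <= supnorm f + supnorm g.
Proof.
apply: supnorm_le => [|i]; first by rewrite addr_ge0.
apply: le_trans (ler_normD (f i) (g i)) _.
exact: lerD (supnorm_ge _ _) (supnorm_ge _ _).
Qed.

Let supnormZ_le (a : R) f : supnorm (a *: f) <= `|a| * supnorm f.
Proof.
apply: supnorm_le => [|i]; first by rewrite mulr_ge0.
by rewrite [X in `|X|](_ : _ = a * f i)// normrM ler_wpM2l.
Qed.

Let supnormZ (a : R) f : supnorm (a *: f) = `|a| * supnorm f.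
Proof.
apply/eqP; rewrite eq_le supnormZ_le /=.
have [->|a0] := eqVneq a 0; first by rewrite normr0 mul0r.
have an0 : 0 < `|a| by rewrite normr_gt0.
have := supnormZ_le a^-1 (a *: f).
rewrite scalerA mulVf// scale1r -(ler_pM2l an0) normfV mulrA.
by rewrite divff ?mul1r// gt_eqF.
Qed.

Let supnorm0_eq0 f : supnorm f = 0 -> f = 0.
Proof.
move=> f0; apply: val_inj; apply/funext => i; apply/eqP.
by rewrite -normr_le0 -f0 supnorm_ge.
Qed.

HB.instance Definition _ := Lmodule_isNormed.Build R (linfty R I)
  supnormD supnormZ supnorm0_eq0.

Lemma linfty_norm_ge f i : `|f i| <= `|f|.
Proof. exact: supnorm_ge. Qed.

Lemma linfty_norm_le f (M : R) : 0 <= M ->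
  (forall i, `|f i| <= M) -> `|f| <= M.
Proof. exact: supnorm_le. Qed.

(** Needed because [hahn_banach_op] speaks of complete spaces [Z] only. The limit is taken
    pointwise; [l_near] makes the convergence uniform, since its bound does not depend on [i]. *)
Lemma linfty_complete (F : set_system (linfty R I)) :
  ProperFilter F -> cauchy F -> cvg F.
Proof.
move=> FF /cauchyP Fc0.
have Fc (e : R) : 0 < e -> exists f : linfty R I, F (ball f e) by exact: Fc0.
have ev_cvg i : cvg ((fun f : linfty R I => f i : R) @ F).
  apply: cauchy_cvg; apply/cauchyP => e e0.
  have [f Ff] := Fc e e0; exists (f i).
  rewrite /nbhs /=; apply: (@filterS _ F _ (ball f e) _ _ Ff) => g.
  rewrite -ball_normE /= => fg.
  exact: le_lt_trans (linfty_norm_ge (f - g) i) fg.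
pose l (i : I) : R^o := lim ((fun f : linfty R I => f i : R) @ F).
have l_near f (e : R) : F (ball f e) -> forall i, `|l i - f i| <= e.
  move=> Ff i; apply/ler_addgt0Pr => e' e'0.
  have := ev_cvg i => /cvgrPdist_lt /(_ e' e'0) Fl.
  have [g [fg /= lg]] := filter_ex (filterI Ff Fl).
  move: fg; rewrite -ball_normE /= => fg.
  have := linfty_norm_ge (g - f) i; rewrite -distrC in fg.
  move=> gf; rewrite (_ : l i - f i = (l i - g i) + (g i - f i)).
    rewrite (le_trans (ler_normD _ _))// addrC lerD// ltW//.
    exact: le_lt_trans gf fg.
  by rewrite addrA subrK.
have [f1 Ff1] := Fc 1 ltr01.
have lb : l \in @is_bounded R I.
  apply/asboolP; exists (1 + `|f1|) => i.
  rewrite -[l i](subrK (f1 i)) (le_trans (ler_normD _ _))// lerD//.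
  exact: l_near Ff1 _.
apply/cvg_ex; exists (@Linfty R I l lb); apply/cvgrPdist_le => e e0.
have e2 : 0 < e / 2 by rewrite divr_gt0.
have [f Ff] := Fc _ e2; apply: filterS (Ff) => g.
rewrite -ball_normE /= => fg; apply: linfty_norm_le => [|i]; first exact: ltW.
rewrite [e]splitr (_ : (_ - g) i = (l i - f i) + (f - g) i).
  rewrite (le_trans (ler_normD _ _))// lerD//; first exact: l_near.
  exact: le_trans (linfty_norm_ge _ _) (ltW fg).
by rewrite /= addrA subrK.
Qed.

HB.instance Definition _ := Uniform_isComplete.Build (linfty R I)
  linfty_complete.

End Linfty.


(** * Linear and affine independence *)

Section LinearIndependence.
Set Implicit Arguments.
Unset Strict Implicit.
Context {R : realType}.

Lemma norm_coord_le m (a : 'rV[R]_m) i : `|a 0 i| <= `|a|.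
Proof.
rewrite [leRHS]/Num.norm /= mx_normrE; apply/bigmax_geP; right => /=.
by exists (0, i).
Qed.

(* By compactness of the unit sphere of ['rV_m]. *)
Lemma lin_indep_norm_ge (V : normedModType R) m (v : 'I_m -> V) :
  lin_indep v -> exists2 c : R, 0 < c &
    forall a : 'rV[R]_m, c * `|a| <= `|\sum_i a 0 i *: v i|.
Proof.
move=> vfree; pose f (a : 'rV[R]_m) := \sum_i a 0 i *: v i.
have fZ t a : f (t *: a) = t *: f a.
  by rewrite /f scaler_sumr; apply: eq_bigr => i _; rewrite mxE scalerA.
pose A := [set a : 'rV[R]_m | `|a| = 1].
have normalized (a : 'rV[R]_m) : a != 0 -> A (`|a|^-1 *: a).
  by move=> a0; rewrite /A /= normrZ normfV normr_id mulVf// normr_eq0.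
have [A0|A0] := pselect (A !=set0); last first.
  exists 1 => // a; have [->|a0] := eqVneq a 0; first by rewrite normr0 mulr0.
  by case: A0; eexists; exact: normalized a0.
have cf : continuous f.
  apply: continuous_big => [|i _ a]; first exact: add_continuous.
  by have /cvgZr_tmp := @coord_continuous R 1 m 0 i a; exact.
have cA : compact A.
  apply: bounded_closed_compact.
    by exists 1; split => // M M1 a /= ->; exact: ltW.
  apply: (preimage_closed (D := [set x : R | x = 1])); last exact: closed_eq.
  by move=> a _; exact: norm_continuous.
have [|b bA fb] := compact_EVT_min (f := fun a => `|f a|) A0 cA.
  apply: continuous_subspaceT => a; exact: cvg_norm (cf a).
rewrite inE in bA.
exists `|f b| => [|a].
  rewrite normr_gt0; apply/eqP => fb0.
  have b0 : b = 0.
    by apply/rowP => i; rewrite mxE; exact: (vfree (fun i => b 0 i) fb0 i).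
  by move: bA; rewrite b0 /A /= normr0 => /eqP; rewrite eq_sym oner_eq0.
have [->|a0] := eqVneq a 0; first by rewrite normr0 mulr0.
have := fb (`|a|^-1 *: a); rewrite inE fZ normrZ normfV normr_id.
by move=> /(_ (normalized _ a0)); rewrite mulrC ler_pdivlMr// normr_gt0.
Qed.

Lemma lin_indep_perturbation (V : normedModType R) m (v : 'I_m -> V) :
  lin_indep v -> exists2 e : R, 0 < e &
    forall w : 'I_m -> V, (forall i, `|v i - w i| <= e) -> lin_indep w.
Proof.
move=> /lin_indep_norm_ge[c c0 cv].
have m1 : 0 < (m.+1%:R : R) by rewrite ltr0n.
(* A relation among the [w i] has the same coefficients on the [v i - w i], so [m] errors of this
   size add up to strictly less than [c] times the norm of the coefficients; [m.+1] gives strictness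
   and covers [m = 0]. *)
exists (c / m.+1%:R) => [|w vw b bw]; first by rewrite divr_gt0.
pose a := \row_i b i.
suff a0 : `|a| = 0.
  by move=> i; have /rowP/(_ i) := normr0_eq0 a0; rewrite !mxE.
apply/eqP; rewrite eq_le normr_ge0 andbT leNgt; apply/negP => a0.
have := cv a; apply/negP; rewrite -ltNge.
rewrite (_ : \sum_i _ = \sum_i a 0 i *: (v i - w i)); last first.
  under [RHS]eq_bigr do rewrite scalerBr.
  rewrite sumrB -[LHS]subr0; congr (_ - _); rewrite -[LHS]bw.
  by apply: eq_bigr => i _; rewrite mxE.
apply: le_lt_trans (_ : \sum_(i < m) `|a| * (c / m.+1%:R) < _).
  apply: le_trans (ler_norm_sum _ _ _) _; apply: ler_sum => i _.
  by rewrite normrZ ler_pM// norm_coord_le.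
rewrite sumr_const card_ord -mulrnAr [ltRHS]mulrC ltr_pM2l// -mulrnAr.
by rewrite gtr_pMr// -[_ *+ m]mulr_natr mulrC ltr_pdivrMr// mul1r ltr_nat.
Qed.

Lemma lin_indep_scale (V : lmodType R) m (w : 'I_m -> V) (t : 'I_m -> R) :
  (forall i, t i != 0) -> lin_indep w -> lin_indep (fun i => t i *: w i).
Proof.
move=> t0 wfree c cw i; apply/eqP.
have cw0 : \sum_j (c j * t j) *: w j = 0.
  by rewrite -[RHS]cw; apply: eq_bigr => j _; rewrite scalerA.
by have /eqP := wfree _ cw0 i; rewrite mulf_eq0 (negbTE (t0 i)) orbF.
Qed.

Lemma aff_indep_translate (V : lmodType R) m (y : V) (w : 'I_m -> V) :
  lin_indep w -> aff_indep (fun i : 'I_m.+1 =>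
    if unlift ord0 i is Some j then y + w j else y).
Proof.
move=> wfree c c0 cp.
have cl i : c (lift ord0 i) = 0.
  apply: (wfree (fun i => c (lift ord0 i))).
  rewrite -[RHS]cp [RHS]big_ord_recl unlift_none.
  under [X in _ = _ + X]eq_bigr do rewrite liftK scalerDr.
  rewrite big_split /= addrA -scaler_suml -scalerDl.
  by move: c0; rewrite big_ord_recl => ->; rewrite scale0r add0r.
move=> i; case: (unliftP ord0 i) => [j ->|->]; first exact: cl.
by move: c0; rewrite big_ord_recl big1 ?addr0.
Qed.

(** Outside the linear span of the [p i], the point [x] could be added to them, against maximality.
    The coefficients are not asked to sum to [1]: the span suffices to carry over the vanishing of
    the [p i] at a vector. *)
Lemma aff_indep_spans (V : lmodType R) (A : set V) d (p : 'I_d.+1 -> V) x :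
  (forall i, A (p i)) -> aff_indep p ->
  (forall q : 'I_d.+2 -> V, (forall i, A (q i)) -> ~ aff_indep q) ->
  A x -> exists c : 'I_d.+1 -> R, x = \sum_i c i *: p i.
Proof.
move=> Ap pind pmax Ax.
pose q (i : 'I_d.+2) := if unlift ord0 i is Some j then p j else x.
have q0 : q ord0 = x by rewrite /q unlift_none.
have ql j : q (lift ord0 j) = p j by rewrite /q liftK.
have Aq i : A (q i) by rewrite /q; case: unliftP.
apply: contrapT => nx; apply: (pmax q Aq) => c.
rewrite big_ord_recl [X in _ -> X = 0 -> _]big_ord_recl q0.
under [X in _ -> _ + X = 0 -> _]eq_bigr do rewrite ql.
move=> c0 cq.
have cx : c ord0 = 0.
  apply/eqP/negPn/negP => cn0; apply: nx.
  exists (fun j => - (c ord0)^-1 * c (lift ord0 j)).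
  under eq_bigr do rewrite -scalerA.
  rewrite -scaler_sumr; move/eqP: cq; rewrite addrC addr_eq0 => /eqP ->.
  by rewrite scalerN scaleNr opprK scalerA mulVf// scale1r.
move: c0 cq; rewrite cx scale0r !add0r => c0 cq i.
case: (unliftP ord0 i) => [j ->|->//].
exact: (pind (fun j => c (lift ord0 j))).
Qed.

(* The rows of a basis of the left kernel of [(p j (u i))_(i, j)] are the
   coefficients of the combinations of [u] annihilated by [p]. *)
Lemma lin_indep_annihilated (X Y : lmodType R) (T : {linear X -> Y}) k n
    (u : 'I_k -> X) (p : 'I_n -> X -> R^o) :
  lin_indep (fun i => T (u i)) -> (forall j, is_linear_functional (p j)) ->
  exists x : 'I_(k - n) -> X, (forall i j, p j (x i) = 0) /\
    lin_indep (fun i => T (x i)).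
Proof.
move=> ufree plin.
have pS j (I : Type) (r : seq I) (a : I -> R) (z : I -> X) :
    p j (\sum_(i <- r) a i *: z i) = \sum_(i <- r) a i * p j (z i).
  elim: r => [|i r IH]; last by rewrite !big_cons plin IH.
  by rewrite !big_nil (linear_functional0 (plin j)).
pose A := \matrix_(i < k, j < n) (p j (u i) : R).
(* Rank-nullity: [A] has [n] columns, hence rank at most [n]. *)
have kn : (k - n <= \rank (kermx A))%N.
  by rewrite mxrank_ker leq_sub2l ?rank_leq_col.
pose B := row_base (kermx A).
pose x (i : 'I_(k - n)) := \sum_l B (widen_ord kn i) l *: u l.
exists x; split => [i j|c cx i].
  have /matrixP/(_ (widen_ord kn i) j) : B *m A = 0.
    by apply/sub_kermxP; rewrite eq_row_base.
  rewrite [in X in X -> _]mxE mxE => BA0.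
  by rewrite pS -[RHS]BA0; apply: eq_bigr => l _; rewrite [A _ _]mxE.
(* Only the first [k - n] rows of the kernel basis are used; padding [c] with zeros allows the
   freeness of the whole basis to be applied. *)
pose c' : 'rV[R]_(\rank (kermx A)) := \row_j
  (if insub (j : nat) is Some i' then c i' else 0).
have cE i' : c' 0 (widen_ord kn i') = c i'.
  by rewrite mxE /= valK.
suff : c' = 0 by move=> /rowP/(_ (widen_ord kn i)); rewrite cE mxE.
apply/(row_free_injr (row_base_free (kermx A))); rewrite /= mul0mx -/B.
apply/rowP => l; rewrite [RHS]mxE.
apply: (ufree (fun l => (c' *m B) 0 l)).
rewrite -[RHS]cx.
under [RHS]eq_bigr do rewrite /x linear_sum scaler_sumr.
rewrite exchange_big /=; apply: eq_bigr => l' _.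
under [RHS]eq_bigr do rewrite linearZ scalerA.
rewrite -scaler_suml mxE; congr (_ *: _).
rewrite (bigID (fun j : 'I_(\rank (kermx A)) => (j < k - n)%N)) /=.
rewrite [X in _ + X]big1 ?addr0; last first.
  by move=> j jk; rewrite mxE insubF ?mul0r//; apply/negbTE.
rewrite (big_ord_narrow kn) /=.
by apply: eq_bigr => j _; rewrite cE.
Qed.

End LinearIndependence.

(** * Norming functionals, the evaluation embedding and tangent directions *)

Section Norming.
Set Implicit Arguments.
Unset Strict Implicit.
Context {R : realType}.

Lemma norm_sublinear (V : normedModType R) : sublinear (fun x : V => `|x|).
Proof.
split=> [x y|t x t0]; first exact: ler_normD.
by rewrite normrZ ger0_norm.
Qed.

Lemma opnorm_ge (U V : normedModType R) (f : {linear U -> V}) u :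
  0 < opnorm f -> `|f u| <= opnorm f * `|u|.
Proof.
move=> f0; set E := [set `|f u| | u in unit_ball U].
(* A set without a supremum has [sup] equal to [0], so [0 < opnorm f] already contains
   boundedness. *)
have [[_ Eub]|Enot] := pselect (has_sup E); last first.
  by move: f0; rewrite /opnorm sup_out// ltxx.
have [->|u0] := eqVneq u 0; first by rewrite linear0 !normr0 mulr0.
have un0 : 0 < `|u| by rewrite normr_gt0.
have : `|f (`|u|^-1 *: u)| <= opnorm f.
  apply: (ub_le_sup Eub); exists (`|u|^-1 *: u) => //.
  by rewrite /unit_ball /= normrZ normfV normr_id mulVf ?gt_eqF.
by rewrite linearZ normrZ normfV normr_id mulrC ler_pdivrMr.
Qed.

Lemma linear_functional_norm_le (V : normedModType R) (f : V -> R^o) x :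
  is_linear_functional f -> (forall y, f y <= `|y|) -> `|f x| <= `|x|.
Proof.
move=> lf fn; rewrite ler_norml fn andbT lerNl -(linear_functionalN lf).
by rewrite -(normrN x) fn.
Qed.

Lemma norming_set_intro (V : normedModType R) (x : V) (f : V -> R^o) :
  is_linear_functional f -> (forall y, f y <= `|y|) -> `|x| = 1 -> f x = 1 ->
  norming_set x f.
Proof.
move=> lf fn x1 fx; split=> //; split=> //.
have ub1 : ubound [set `|f u| | u in unit_ball V] 1.
  by move=> _ [u u1 <-]; exact: le_trans (linear_functional_norm_le u lf fn) u1.
have mem1 : [set `|f u| | u in unit_ball V] 1.
  by exists x; rewrite ?fx ?normr1// /unit_ball /= x1.
apply/eqP; rewrite eq_le; apply/andP; split.
  by apply: ge_sup => //; exists 1.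
by apply: ub_le_sup => //; exists 1.
Qed.

(* [directional norm x0] is the one-sided derivative of the norm at [x0]; its
   linear minorants are the norming functionals of [x0], so it vanishes at
   every vector they annihilate. *)
Lemma norming_annihilator_tangent (V : normedModType R) (x0 x : V) (e : R) :
  `|x0| = 1 -> (forall f, norming_set x0 f -> f x = 0) -> 0 < e ->
  exists2 s : R, 0 <= s & `|x + s *: x0| <= s + e.
Proof.
move=> x01 Nx e0; have sn := norm_sublinear V.
have [f [lf fq fx]] := Hahn_Banach_at x (directional_sublinear x0 sn).
have fn y : f y <= `|y| := le_trans (fq y) (directional_le x0 sn y).
have fx0 : f x0 = 1.
  apply/eqP; rewrite eq_le -{1}x01 fn /=.
  have := le_trans (fq (- x0)) (directional_opp x0 sn).
  by rewrite (linear_functionalN lf) x01 lerN2.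
have qx : directional (fun x : V => `|x|) x0 x = 0.
  by rewrite -fx; apply: Nx; exact: norming_set_intro.
have [s s0] := directional_adherent x0 sn x e0.
rewrite qx x01 mulr1 add0r => se; exists s => //; lra.
Qed.

(** The one-sided bound is the form that Hahn-Banach delivers; applied to [- u] it bounds the
    absolute value. *)
Definition dual_ball (X : normedModType R) :=
  {g : X -> R^o | is_linear_functional g /\ forall u, g u <= `|u|}.

Lemma dual_ball_opp (X : normedModType R) (g : dual_ball X) :
  exists h : dual_ball X, forall x, sval h x = - sval g x.
Proof.
case: g => g [lg gn].
have h : is_linear_functional (fun x => - g x : R^o).
  by move=> a u v; rewrite lg opprD mulrN.
have hn u : - g u <= `|u| by rewrite -(linear_functionalN lg) -(normrN u).
by exists (exist _ (fun x => - g x : R^o) (conj h hn)).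
Qed.

Lemma dual_ball_norm_le (X : normedModType R) (g : dual_ball X) x :
  `|sval g x| <= `|x|.
Proof. by apply: linear_functional_norm_le; case: g => g []. Qed.

Lemma evaluation_bounded (X : normedModType R) (x : X) :
  (fun g : dual_ball X => sval g x) \in @is_bounded R (dual_ball X).
Proof. by apply/asboolP; exists `|x| => g; exact: dual_ball_norm_le. Qed.

Definition evaluation (X : normedModType R) (x : X) : linfty R (dual_ball X) :=
  @Linfty R (dual_ball X) _ (evaluation_bounded x).

Lemma evaluation_linear (X : normedModType R) :
  linear (@evaluation X : X -> linfty R (dual_ball X)).
Proof.
move=> a x y; apply: val_inj; apply/funext => g /=.
by case: g => g [lg gn] /=; rewrite lg.
Qed.

HB.instance Definition _ (X : normedModType R) :=
  GRing.isLinear.Build R X (linfty R (dual_ball X)) *:%R (@evaluation X)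
    (@evaluation_linear X).

Lemma evaluation_isometry (X : normedModType R) (x : X) :
  `|evaluation x| = `|x|.
Proof.
apply/eqP; rewrite eq_le; apply/andP; split.
  by apply: linfty_norm_le => // g; exact: dual_ball_norm_le.
have [f [lf fn fx]] := Hahn_Banach_at x (norm_sublinear X).
have := linfty_norm_ge (evaluation x) (exist _ f (conj lf fn)).
by rewrite /= fx normr_id.
Qed.

(** For [0 <= e], this is [a] minus its truncation to the interval [[- e, e]]. *)
Definition soft_threshold (e a : R) : R := a - Num.max (- e) (Num.min e a).

Lemma soft_threshold_close e a : 0 <= e -> `|a - soft_threshold e a| <= e.
Proof.
move=> e0; rewrite /soft_threshold ler_norml.
by case: (leP e a) => ?; [case: (leP (- e) e)|case: (leP (- e) a)] => ?;
  apply/andP; split; lra.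
Qed.

Lemma soft_threshold_norm_le e a c : 0 <= e -> 0 <= c -> `|a| <= e + c ->
  `|soft_threshold e a| <= c.
Proof.
rewrite /soft_threshold !ler_norml => e0 c0 /andP[ac1 ac2].
by case: (leP e a) => ?; [case: (leP (- e) e)|case: (leP (- e) a)] => ?;
  apply/andP; split; lra.
Qed.

(* [z] is [evaluation x] shrunk towards [0] by [e]: it vanishes unless
   [`|g x| > e], which forces [1 - `|g x0|] to be bounded below by a multiple
   of [`|g x| - e], leaving room to move from [evaluation x0] along [z]. *)
Lemma evaluation_tangent (X : normedModType R) (x0 x : X) (e : R) :
  `|x0| = 1 -> (forall f, norming_set x0 f -> f x = 0) -> 0 < e ->
  exists z : linfty R (dual_ball X), exists2 t : R, 0 < t &
    [/\ `|evaluation x - z| <= e, `|evaluation x0 + t *: z| <= 1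
      & `|evaluation x0 - t *: z| <= 1].
Proof.
move=> x01 Nx e0.
have [s s0 xs] := norming_annihilator_tangent x01 Nx e0.
have [|s' s'0 xs'] := norming_annihilator_tangent (x := - x) x01 _ e0.
  by move=> f Nf; rewrite (linear_functionalN Nf.1) Nx ?oppr0.
(* Applying [g] to [x + s *: x0] gives [g x <= e + s * (1 - g x0)]; [- x] and [s'] give the other
   sign. *)
have half (g : dual_ball X) :
    `|sval g x| <= e + (s + s') * (1 - sval g x0).
  case: g => g [lg gn] /=.
  have g1 : g x0 <= 1 by rewrite -x01.
  have := le_trans (gn _) xs; have := le_trans (gn _) xs'.
  rewrite !(linear_functionalD lg) !(linear_functionalZ lg).
  rewrite (linear_functionalN lg).
  move=> h1 h2; rewrite ler_norml; apply/andP; split; nra.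
have gx0 (g : dual_ball X) : `|sval g x0| <= 1.
  by rewrite -x01 dual_ball_norm_le.
(* Where [g x0] is negative, [half] is applied to the opposite functional. *)
have bound (g : dual_ball X) :
    `|sval g x| <= e + (s + s') * (1 - `|sval g x0|).
  have [h hE] := dual_ball_opp g; have := half h; have := half g.
  by rewrite !hE normrN; case: (ger0P (sval g x0)).
pose z0 (g : dual_ball X) : R^o := soft_threshold e (sval g x).
have z0_le g : `|z0 g| <= (s + s') * (1 - `|sval g x0|).
  apply: soft_threshold_norm_le (ltW e0) _ (bound g).
  by rewrite mulr_ge0 ?subr_ge0 ?addr_ge0.
have z0b : z0 \in @is_bounded R (dual_ball X).
  apply/asboolP; exists (s + s') => g; apply: le_trans (z0_le g) _.
  by rewrite ler_piMr ?addr_ge0// gerBl.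
(* Chosen so that [t * (s + s') <= 1]; the summand [1] keeps the denominator positive when [s] and
   [s'] vanish. *)
pose t := (s + s' + 1)^-1.
have t0 : 0 < t by rewrite invr_gt0 ltr_wpDl// addr_ge0.
have tz g : `|t * z0 g| <= 1 - `|sval g x0|.
  rewrite normrM gtr0_norm// mulrC ler_pdivrMr ?ltr_wpDl ?addr_ge0//.
  by apply: le_trans (z0_le g) _; rewrite mulrC ler_wpM2l ?subr_ge0// lerDl.
exists (@Linfty R (dual_ball X) z0 z0b), t => //; split.
- apply: linfty_norm_le => [|g]; first exact: ltW.
  by apply: soft_threshold_close; exact: ltW.
- apply: linfty_norm_le => // g; apply: le_trans (ler_normD _ _) _.
  by rewrite addrC -lerBrDr; exact: tz.
- apply: linfty_norm_le => // g; apply: le_trans (ler_normB _ _) _.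
  by rewrite addrC -lerBrDr; exact: tz.
Qed.

End Norming.

(** * The support set at [T x0] and affinely independent points in it *)

Theorem theorem1 (R : realType) (X Y : completeNormedModType R)
    (T : {linear X -> Y}) (k d : nat) (x0 : X) :
  finite_dim X -> finite_dim Y ->
  hahn_banach_op T -> rank_eq T k -> opnorm T = 1 ->
  `|x0| = 1 -> `|T x0| = 1 ->
  affdim_eq (norming_set x0) d ->
  exists S : set Y, support_set S /\ S (T x0) /\
    affdim_ge S (k%:Z - 1 - d%:Z).
Proof.
move=> _ _ HT [[v [Tv vfree]] _] T1 x01 Tx01 [[p [Np pind]] pmax].
have [Tt [_ [Tt1 TtE]]] :=
  HT (linfty R (dual_ball X)) (@evaluation R X) (@evaluation_isometry R X).
rewrite T1 in Tt1.
have Tt_le z : `|Tt z| <= `|z|.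
  by have := opnorm_ge (f := Tt) z; rewrite Tt1 mul1r; apply.
have [f [lf fn fy]] := Hahn_Banach_at (T x0) (norm_sublinear Y).
rewrite Tx01 in fy.
have /choice[u uv] i : exists u, T u = v i.
  by have [w _ wv] := Tv i; exists w.
have Tufree : lin_indep (fun i => T (u i)).
  by rewrite (_ : (fun i => T (u i)) = v)//; apply/funext.
have [x [px xfree]] := lin_indep_annihilated Tufree (fun j => (Np j).1).
(* The [d.+1] points [p j] span all norming functionals, so vanishing on these is only [d.+1] linear
   conditions. *)
have Nx i g : norming_set x0 g -> g (x i) = 0.
  move=> Ng; have [c ->] := aff_indep_spans Np pind pmax Ng.
  rewrite fct_sumE big1// => j _.
  by rewrite [LHS](_ : _ = c j * p j (x i))// px mulr0.
have [e e0 perturb] := lin_indep_perturbation xfree.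
have /choice[z /choice[t zt]] : forall i, exists z, exists t : R,
    [/\ 0 < t, `|evaluation (x i) - z| <= e, `|evaluation x0 + t *: z| <= 1
      & `|evaluation x0 - t *: z| <= 1].
  by move=> i; have [z [t t0 []]] := evaluation_tangent x01 (Nx i) e0;
    exists z, t.
pose S := unit_ball Y `&` [set y | f y = 1].
have STx0 : S (T x0) by split; rewrite /unit_ball /= ?Tx01.
exists S; split; [|split => //].
  exists f, 1; split=> //; split; first by exists (T x0); rewrite fy oner_neq0.
  split; first by move=> y; exact: le_trans.
  by split=> //; exists (T x0); split=> //; rewrite /unit_ball /= Tx01.
(* Truncated subtraction: if [k <= d], the single point [T x0] is enough. *)
exists (k - d.+1)%N; split; first by lia.
pose w i := t i *: Tt (z i).
have wfree : lin_indep w.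
  apply: lin_indep_scale => [i|].
    by have [t0 _ _ _] := zt i; rewrite gt_eqF.
  apply: perturb => i; have [_ ze _ _] := zt i.
  by rewrite -TtE -linearB; exact: le_trans (Tt_le _) ze.
have Sw i : S (T x0 + w i).
  have [_ _ zD zB] := zt i.
  have TD : `|T x0 + w i| <= 1.
    by rewrite -TtE /w -linearZ -linearD; exact: le_trans (Tt_le _) zD.
  have TB : `|T x0 - w i| <= 1.
    by rewrite -TtE /w -linearZ -linearB; exact: le_trans (Tt_le _) zB.
  (* The values of [f] at [T x0 + w i] and [T x0 - w i] are at most [1] and average to
     [f (T x0) = 1], so both equal [1]. *)
  split => //=; have := le_trans (fn _) TD; have := le_trans (fn _) TB.
  rewrite !(linear_functionalD lf) (linear_functionalN lf) fy; lra.
exists (fun i => if unlift ord0 i is Some j then T x0 + w j else T x0).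
split; last exact: aff_indep_translate.
by move=> i /=; case: unliftP.
Qed.
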